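(* Let $p,q\in\mathbb C$ with $p+q=1$. The quantum vector pre-measure $\mu_{\mathsf v}:\mathfrak A\to\mathcal H$ of complex percolation with parameter $p$ extends to a vector measure on the sigma algebra $\mathfrak S_{\mathfrak A}$ generated by $\mathfrak A$ if and only if $p$ is real with $p\in[0,1]$ (i.e. exactly when the amplitudes are real and non-negative).
   Context: Labelled causal sets: an $n$-element labelled causal set $C^n$ is a strict partial order $\prec$ on $\{1,\dots,n\}$ such that $i\prec j$ implies $i<j$. Two elements are linked if they are related and no element lies strictly between them. $\Omega$ is the set of infinite labelled causal sets, i.e. strict partial orders on $\{1,2,3,\dots\}$ with $i\prec j\Rightarrow i<j$ (these are automatically past finite). $\mathrm{cyl}(C^n)\subset\Omega$ is the set of $c\in\Omega$ whose restriction to $\{1,\dots,n\}$ is $C^n$. $\mathfrak A$ is the algebra of all finite unions of such cylinder sets; each element is a finite disjoint union of cylinder sets. Complex percolation with parameter $p\in\mathbb C$, $q=1-p$: if $C^{n+1}$ restricts to $C^n$ and its new element $n+1$ is linked to exactly $u$ elements of $C^n$ and unrelated to exactly $v$ elements of $C^n$, the transition amplitude is $p^uq^v$ (convention $0^0=1$). The amplitude $A(C^n)$ is the product of the transition amplitudes starting from the one-element causal set (with amplitude $1$); equivalently $A(C^n)=p^Lq^{\binom n2-R}$ with $L$ the number of links and $R$ the number of relations of $C^n$. Setting $A(\mathrm{cyl}(C^n))=A(C^n)$ defines a finitely additive $A:\mathfrak A\to\mathbb C$ with $A(\Omega)=1$, and the decoherence functional is $D(\alpha,\beta)=A^*(\alpha)A(\beta)$.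 Histories Hilbert space: let $V$ be the space of finitely supported functions $u:\mathfrak A\to\mathbb C$ with $\langle u,v\rangle_V=\sum_{\alpha,\beta}u^*(\alpha)v(\beta)D(\alpha,\beta)$; $\mathcal H$ is the Hilbert space of Cauchy sequences in $V$ modulo $\{u_i\}\sim\{v_i\}$ iff $\|u_i-v_i\|_V\to0$. The quantum vector pre-measure is $\mu_{\mathsf v}(\alpha)=[\chi_\alpha]\in\mathcal H$, with $\chi_\alpha\in V$ equal to $1$ at $\alpha$ and $0$ elsewhere; it is finitely additive and $\langle\mu_{\mathsf v}(\alpha),\mu_{\mathsf v}(\beta)\rangle=D(\alpha,\beta)$. (Here $\mathcal H\simeq\mathbb C$ and $\mu_{\mathsf v}$ equals $A$ up to a phase.) A vector measure on $\mathfrak S_{\mathfrak A}$ is a map $\mathfrak S_{\mathfrak A}\to\mathcal H$ that is countably additive in norm on every sequence of pairwise disjoint sets. The pre-measure $\mu_{\mathsf v}$ extends to $\mathfrak S_{\mathfrak A}$ if there is a unique vector measure $\overline{\mu_{\mathsf v}}:\mathfrak S_{\mathfrak A}\to\mathcal H$ with $\overline{\mu_{\mathsf v}}|_{\mathfrak A}=\mu_{\mathsf v}$. *)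

(* Defs.v *)
From HB Require Import structures.
From mathcomp Require Import all_boot all_order all_algebra.
From mathcomp Require Import complex.
From mathcomp Require Import all_classical all_reals all_analysis.

Set Implicit Arguments.
Unset Strict Implicit.
Unset Printing Implicit Defensive.
Import Order.TTheory GRing.Theory Num.Theory.
Import numFieldNormedType.Exports.
Local Open Scope classical_set_scope.
Local Open Scope complex_scope.
Local Open Scope ring_scope.

(* Complex numbers are R[i] with R : realType; R[i]^o is R[i] regarded as a
   module over itself, the form in which it carries its usual topology. *)

(* Elements are numbered from 0 (not from 1), so that the ground set of an
   n-element causal set is 'I_n and that of an infinite one is nat.  *)

Definition is_causet (n : nat) (r : {set 'I_n * 'I_n}) : bool :=
  [&& [forall i, (i, i) \notin r],
      [forall i, forall j, forall k,
         ((i, j) \in r) ==> ((j, k) \in r) ==> ((i, k) \in r)]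
    & [forall i : 'I_n, forall j : 'I_n, ((i, j) \in r) ==> (i < j)%N]].

Record causet (n : nat) := Causet {
  prec :> {set 'I_n * 'I_n};
  _ : is_causet prec }.

HB.instance Definition _ n := [isSub for @prec n].
HB.instance Definition _ n := [Finite of causet n by <:].

Definition linked n (C : causet n) (i j : 'I_n) : bool :=
  ((i, j) \in prec C) &&
  ~~ [exists k, ((i, k) \in prec C) && ((k, j) \in prec C)].

Definition unrelated n (C : causet n) (i j : 'I_n) : bool :=
  [&& i != j, (i, j) \notin prec C & (j, i) \notin prec C].

Definition restr_set n (r : {set 'I_n.+1 * 'I_n.+1}) : {set 'I_n * 'I_n} :=
  [set ij | (widen_ord (leqnSn n) ij.1, widen_ord (leqnSn n) ij.2) \in r].

Lemma restr_subproof n (C : causet n.+1) : is_causet (restr_set C).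
Proof.
case: C => r /=; rewrite /is_causet => /and3P[/forallP ir tr lt].
apply/and3P; split.
- by apply/forallP => i; rewrite inE ir.
- apply/forallP => i; apply/forallP => j; apply/forallP => k.
  rewrite !inE; move/forallP: tr => /(_ (widen_ord (leqnSn n) i)) /forallP.
  by move=> /(_ (widen_ord (leqnSn n) j)) /forallP /(_ (widen_ord (leqnSn n) k)).
- apply/forallP => i; apply/forallP => j; rewrite inE.
  move/forallP: lt => /(_ (widen_ord (leqnSn n) i)) /forallP.
  by move=> /(_ (widen_ord (leqnSn n) j)).
Qed.

Definition restr n (C : causet n.+1) : causet n := Causet (restr_subproof C).

Record inf_causet := InfCauset {
  iprec :> nat -> nat -> bool;
  iprec_irr : irreflexive iprec;
  iprec_trans : transitive iprec;
  iprec_lt : forall i j, iprec i j -> (i < j)%N }.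

Local Notation Omega := inf_causet.

Definition cyl n (C : causet n) : set Omega :=
  [set c : Omega | forall i j : 'I_n, iprec c i j = ((i, j) \in prec C)].

(* The case n = 0 adds nothing: the cylinder of the empty causal set is the
   whole space, as is that of the one-element causal set.  *)
Definition cylinders : set (set Omega) :=
  [set E | exists n (C : causet n), E = cyl C].

Definition cyl_algebra : set (set Omega) :=
  [set E | exists F : set (set Omega),
     [/\ finite_set F, F `<=` cylinders & E = \bigcup_(X in F) X]].

Definition cyl_sigma : set (set Omega) := <<s cyl_algebra >>.

Section Sequences.
Variable K : numFieldType.
Implicit Types z w : nat -> K^o.

Lemma norm_seq_cvg0 z :
  `|z n| @[n --> \oo] --> (0 : K^o) <-> z n @[n --> \oo] --> (0 : K^o).
Proof. exact: norm_cvg0P. Qed.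

Lemma seq_cvgZD (c a b : K) z w :
  z n @[n --> \oo] --> (a : K^o) -> w n @[n --> \oo] --> (b : K^o) ->
  (c * z n + w n : K^o) @[n --> \oo] --> (c * a + b : K^o).
Proof. by move=> za wb; apply: cvgD => //; apply: cvgMl_tmp. Qed.

Lemma seq_cvg_cst (a : K) : (a : K^o) @[n --> \oo] --> (a : K^o).
Proof. exact: cvg_cst. Qed.

Lemma seq_cvgM (a b : K) z w :
  z n @[n --> \oo] --> (a : K^o) -> w n @[n --> \oo] --> (b : K^o) ->
  (z n * w n : K^o) @[n --> \oo] --> (a * b : K^o).
Proof. exact: cvgM. Qed.

Lemma seq_lim (a : K) z :
  z n @[n --> \oo] --> (a : K^o) -> lim (z n @[n --> \oo]) = a.
Proof. by move=> h; apply: cvg_lim. Qed.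

Lemma seq_cvgP (a : K) z : z n @[n --> \oo] --> (a : K^o) <->
  (forall e : K, 0 < e -> exists N, forall n, (N <= n)%N -> `|z n - a| < e).
Proof.
split=> [/cvgrPdist_lt za e e0|h].
  by have [N _ h] := za e e0; exists N => n /h; rewrite distrC.
apply/cvgrPdist_lt => e e0; have [N hN] := h e e0.
by exists N => // n /hN; rewrite distrC.
Qed.

End Sequences.

Section ComplexSequences.
Variable R : realType.
Implicit Type z : nat -> R[i].

Lemma real_cauchy_cvg (x : nat -> R) :
  (forall e : R, 0 < e -> exists N, forall m n,
     (N <= m)%N -> (N <= n)%N -> `|x m - x n| < e) ->
  exists l, forall e : R, 0 < e -> exists N, forall n, (N <= n)%N ->
    `|x n - l| < e.
Proof.
move=> h; have /R_complete cx : cauchy (x n @[n --> \oo]).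
  apply/cauchyP => e e0; have [N hN] := h e e0; exists (x N), N => // n Nn.
  by rewrite /ball/=; exact: hN.
exists (lim (x n @[n --> \oo])); apply/(seq_cvgP _ (x : nat -> R^o)).
exact: cx.
Qed.

Lemma normc_ge_Im (x : R[i]) : `|complex.Im x|%:C <= `|x|.
Proof.
by case: x => a b; rewrite normc_def lecR /= -sqrtr_sqr ler_wsqrtr// lerDr sqr_ge0.
Qed.

Lemma complex_cauchy_cvg z :
  (forall e : R[i], 0 < e -> exists N, forall m n,
     (N <= m)%N -> (N <= n)%N -> `|z m - z n| < e) ->
  exists l : R[i], (z n : R[i]^o) @[n --> \oo] --> (l : R[i]^o).
Proof.
move=> h.
have [l1 l1P] : exists l, forall e : R, 0 < e -> exists N, forall n,
    (N <= n)%N -> `|complex.Re (z n) - l| < e.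
  apply: real_cauchy_cvg => e e0.
  have [|N hN] := h e%:C; first by rewrite ltcR.
  exists N => m n Nm Nn; rewrite -ltcR -raddfB.
  exact: le_lt_trans (normc_ge_Re _) (hN _ _ Nm Nn).
have [l2 l2P] : exists l, forall e : R, 0 < e -> exists N, forall n,
    (N <= n)%N -> `|complex.Im (z n) - l| < e.
  apply: real_cauchy_cvg => e e0.
  have [|N hN] := h e%:C; first by rewrite ltcR.
  exists N => m n Nm Nn; rewrite -ltcR -raddfB.
  exact: le_lt_trans (normc_ge_Im _) (hN _ _ Nm Nn).
exists (l1 +i* l2); apply/(seq_cvgP _ (z : nat -> R[i]^o)) => e e0.
have er : e = (complex.Re e)%:C.
  by move: e0; case: (e) => a b; rewrite ltcE /= => /andP[/eqP -> _].
have e20 : 0 < complex.Re e / 2 by rewrite divr_gt0// -ltcR -er.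
have [N1 h1] := l1P _ e20; have [N2 h2] := l2P _ e20.
exists (maxn N1 N2) => n; rewrite geq_max => /andP[/h1 {}h1 /h2 {}h2].
rewrite er (splitr (complex.Re e)) rmorphD.
have -> : z n - (l1 +i* l2) =
    (complex.Re (z n) - l1)%:C + (0 +i* (complex.Im (z n) - l2)).
  by case: (z n) => a b /=; simpc.
apply: (le_lt_trans (ler_normD _ _)).
by apply: ltrD; rewrite normc_def /= expr0n /= ?addr0 ?add0r sqrtr_sqr ltcR.
Qed.

End ComplexSequences.

Section FiniteSupport.
Variable R : realType.

Definition fin_supp : {pred cyl_algebra -> R[i]^o} :=
  fun u => `[< finite_set [set a | u a != 0] >].

Lemma fin_supp_submod_closed : submod_closed fin_supp.
Proof.
split; first by apply/asboolP; rewrite (_ : [set _ | _] = set0)//;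
  apply/seteqP; split => a //=; rewrite eqxx.
move=> c u v /asboolP fu /asboolP fv; apply/asboolP.
apply: (@sub_finite_set _ _ ([set a | u a != 0] `|` [set a | v a != 0])).
  move=> a /=; apply: contraNP => /not_orP[].
  move=> /negP/negPn/eqP u0 /negP/negPn/eqP v0; apply/eqP.
  by rewrite !fctE u0 v0 scaler0 addr0.
by rewrite finite_setU.
Qed.

HB.instance Definition _ :=
  GRing.isSubmodClosed.Build R[i] (cyl_algebra -> R[i]^o) fin_supp
    fin_supp_submod_closed.

Record histV := HistV {
  histV_fun :> cyl_algebra -> R[i]^o;
  _ : histV_fun \in fin_supp }.

HB.instance Definition _ := [isSub for histV_fun].
HB.instance Definition _ := [Choice of histV by <:].
HB.instance Definition _ := [SubChoice_isSubLmodule of histV by <:].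

Lemma chi_subproof (a : cyl_algebra) :
  (fun b => (b == a)%:R : R[i]^o) \in fin_supp.
Proof.
apply/asboolP; apply: (@sub_finite_set _ _ [set a]); last exact: finite_set1.
by move=> b /=; case: (b =P a) => [->//|_]; rewrite mulr0n eqxx.
Qed.

Definition chi (a : cyl_algebra) : histV := HistV (chi_subproof a).

End FiniteSupport.

Section Percolation.
Variables (R : realType) (p q : R[i]).

Definition transition n (C : causet n.+1) : R[i] :=
  p ^+ #|[pred i | linked C i ord_max]| *
  q ^+ #|[pred i | unrelated C i ord_max]|.

(* The transition from the empty to the one-element causal set contributes
   p ^+ 0 * q ^+ 0 = 1. *)
Fixpoint amp (n : nat) : causet n -> R[i] :=
  match n with
  | 0 => fun=> 1
  | m.+1 => fun C => amp (restr C) * transition C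
  end.

Definition has_level (E : set Omega) (n : nat) : Prop :=
  E = \bigcup_(C in [set C : causet n | cyl C `<=` E]) cyl C.

(* The additive extension of [amp] from cylinders to finite unions of them: a
   finite union of cylinders is a disjoint union of cylinders of causal sets of
   one common size n, and for p + q = 1 the sum does not depend on the n
   chosen. *)
Definition ampl (a : cyl_algebra) : R[i] :=
  \sum_(C : causet (get [set n | has_level (val a) n])
         | `[< cyl C `<=` val a >]) amp C.

Definition decoh (a b : cyl_algebra) : R[i] := (ampl a)^* * ampl b.

Definition dotV (u v : histV R) : R[i] :=
  \sum_(a \in [set: cyl_algebra]) \sum_(b \in [set: cyl_algebra])
     (u a)^* * v b * decoh a b.

Definition normV (u : histV R) : R[i] := sqrtC (dotV u u).

(* dotV is the rank-one form (totV u)^* * totV v, cf. dotVE. *)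
Definition totV (u : histV R) : R[i] :=
  \sum_(a \in [set: cyl_algebra]) u a * ampl a.

Lemma totVE (u : histV R) (X : set cyl_algebra) : finite_set X ->
  [set a | u a != 0] `<=` X -> totV u = \sum_(a \in X) u a * ampl a.
Proof.
move=> fX uX; rewrite /totV; apply/esym/fsbig_widen => // a [_ /= Xa].
by have [->|/uX//] := eqVneq (u a) 0; rewrite mul0r.
Qed.

Lemma histV_fin (u : histV R) : finite_set [set a | u a != 0].
Proof. by case: u => u fu; apply/asboolP. Qed.

Lemma totV_linear c (u v : histV R) : totV (c *: u + v) = c * totV u + totV v.
Proof.
pose X := [set a | u a != 0] `|` [set a | v a != 0].
have fX : finite_set X by rewrite finite_setU; split; exact: histV_fin.
rewrite (@totVE u X)//; last by move=> a ?; left.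
rewrite (@totVE v X)//; last by move=> a ?; right.
rewrite (@totVE _ X)//; last first.
  move=> a; rewrite /X /=; apply: contraNP => /not_orP[].
  move=> /negP/negPn/eqP u0 /negP/negPn/eqP v0; apply/eqP.
  by rewrite !fctE u0 v0 scaler0 addr0.
rewrite mulr_fsumr -fsbig_split//; apply: eq_fsbigr => a _ /=.
by rewrite !fctE mulrDl mulrA.
Qed.

Lemma totVB u v : totV (u - v) = totV u - totV v.
Proof. by rewrite addrC -scaleN1r totV_linear mulN1r addrC. Qed.

Lemma totVD u v : totV (u + v) = totV u + totV v.
Proof. by rewrite -[u]scale1r totV_linear mul1r scale1r. Qed.

Lemma totV0 : totV 0 = 0.
Proof. by rewrite -(subrr 0) totVB subrr. Qed.

Lemma totVZ c u : totV (c *: u) = c * totV u.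
Proof. by rewrite -[c *: u]addr0 totV_linear totV0 addr0. Qed.

Lemma totV_chi a : totV (chi R a) = ampl a.
Proof.
rewrite (@totVE _ [set a])//; first by rewrite fsbig_set1 /= eqxx mul1r.
by move=> b /=; case: (b =P a) => [->//|_]; rewrite mulr0n eqxx.
Qed.

Lemma dotVE u v : dotV u v = (totV u)^* * totV v.
Proof.
have -> : (totV u)^* = \sum_(a \in [set: cyl_algebra]) (u a)^* * (ampl a)^*.
  have fu := histV_fin u.
  rewrite (totVE fu)//.
  have <- : \sum_(a \in [set a | u a != 0]) (u a)^* * (ampl a)^* =
            \sum_(a \in [set: cyl_algebra]) (u a)^* * (ampl a)^*.
    apply: fsbig_widen => // a [_ /= /negP/negPn/eqP ->].
    by rewrite rmorph0 mul0r.
  rewrite !fsbig_finite//= rmorph_sum.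
  by apply: eq_bigr => a _; rewrite rmorphM.
rewrite mulr_fsuml; apply: eq_fsbigr => a _.
rewrite mulr_fsumr; apply: eq_fsbigr => b _.
by rewrite /decoh mulrACA.
Qed.

Lemma normVE u : normV u = `|totV u|.
Proof. by rewrite /normV dotVE -normCKC sqrCK. Qed.

Definition cauchyV_seq : {pred nat -> histV R} :=
  fun u => `[< forall e : R[i], 0 < e -> exists N, forall m n,
    (N <= m)%N -> (N <= n)%N -> normV (u m - u n) < e >].

Lemma cauchyV_submod_closed : submod_closed cauchyV_seq.
Proof.
split.
  apply/asboolP => e e0; exists 0 => m n _ _.
  by rewrite subrr normVE totV0 normr0.
move=> c u v /asboolP cu /asboolP cv; apply/asboolP => e e0.
have d0 : 0 < e / 2 / (`|c| + 1).
  by rewrite !divr_gt0 ?ltr_wpDl.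
have [N1 uN] := cu _ d0.
have e20 : 0 < e / 2 by rewrite divr_gt0.
have [N2 vN] := cv _ e20.
exists (maxn N1 N2) => m n; rewrite !geq_max => /andP[m1 m2] /andP[n1 n2].
have := uN _ _ m1 n1; have := vN _ _ m2 n2.
rewrite !normVE !fctE !totVB !totV_linear => lev leu.
rewrite opprD addrACA -mulrBr.
apply: (le_lt_trans (ler_normD _ _)); rewrite [e]splitr normrM.
apply: ler_ltD => //.
apply: (@le_trans _ _ ((`|c| + 1) * (e / 2 / (`|c| + 1)))).
  by apply: ler_pM => //; [rewrite lerDl|exact: ltW].
by rewrite mulrCA divff ?mulr1// gt_eqF// ltr_wpDl.
Qed.

HB.instance Definition _ :=
  GRing.isSubmodClosed.Build R[i] (nat -> histV R) cauchyV_seq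
    cauchyV_submod_closed.

Record cauchyV := CauchyV {
  cauchyV_val :> nat -> histV R;
  _ : cauchyV_val \in cauchyV_seq }.

HB.instance Definition _ := [isSub for cauchyV_val].
HB.instance Definition _ := [Choice of cauchyV by <:].
HB.instance Definition _ := [SubChoice_isSubLmodule of cauchyV by <:].

Definition nullV : {pred cauchyV} :=
  fun u => `[< (normV (u n) : R[i]^o) @[n --> \oo] --> (0 : R[i]^o) >].

Lemma normV_cvg0 (u : nat -> histV R) :
  (normV (u n) : R[i]^o) @[n --> \oo] --> (0 : R[i]^o) <->
  (totV (u n) : R[i]^o) @[n --> \oo] --> (0 : R[i]^o).
Proof.
rewrite (_ : (fun n => normV _) = fun n => `|totV (u n)|); last first.
  by apply/funext => n; rewrite normVE.
exact: norm_seq_cvg0.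
Qed.

Lemma nullV_submod_closed : submod_closed nullV.
Proof.
split.
  apply/asboolP/normV_cvg0 => /=.
  rewrite (_ : (fun n => _) = cst 0); first exact: cvg_cst.
  by apply/funext => n; rewrite totV0.
move=> c u v /asboolP/normV_cvg0 nu /asboolP/normV_cvg0 nv.
apply/asboolP/normV_cvg0.
rewrite (_ : (fun n => _) = fun n => c * totV (u n) + totV (v n)).
  have c0 : c * 0 + 0 = 0 :> R[i] by rewrite mulr0 addr0.
  by have := @seq_cvgZD _ c _ _ _ _ nu nv; rewrite c0.
by apply/funext => n; rewrite /= !fctE totV_linear.
Qed.

HB.instance Definition _ :=
  GRing.isSubmodClosed.Build R[i] cauchyV nullV nullV_submod_closed.

(* Cauchy sequences modulo the sequences of norm tending to 0. *)
Definition histH := {ideal_quot nullV}.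

HB.instance Definition _ := GRing.Zmodule.on histH.

Definition piH (u : cauchyV) : histH := \pi_(histH)%qT u.

Lemma piH_eq u v : (piH u == piH v) = (u - v \in nullV).
Proof. by rewrite Quotient.idealrBE. Qed.

Lemma piHD u v : piH (u + v) = piH u + piH v.
Proof. exact: Quotient.pi_add. Qed.

Lemma reprH x : piH (repr x) = x.
Proof. exact: reprK. Qed.

Definition scaleH (c : R[i]) (x : histH) : histH := piH (c *: repr x).

Lemma piHZ c u : piH (c *: u) = scaleH c (piH u).
Proof.
apply/eqP; rewrite /scaleH piH_eq -scalerBr rpredZ//.
by rewrite -piH_eq reprH.
Qed.

Fact scaleHA a b x : scaleH a (scaleH b x) = scaleH (a * b) x.
Proof. by rewrite -[x]reprH -!piHZ scalerA. Qed.

Fact scaleH1 : left_id 1 scaleH.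
Proof. by move=> x; rewrite -[x]reprH -!piHZ scale1r. Qed.

Fact scaleHDr : right_distributive scaleH +%R.
Proof. by move=> c x y; rewrite -[x]reprH -[y]reprH -!(piHD, piHZ) scalerDr. Qed.

Fact scaleHDl x : {morph scaleH^~ x : a b / a + b}.
Proof. by move=> a b; rewrite -[x]reprH -!(piHD, piHZ) scalerDl. Qed.

HB.instance Definition _ :=
  GRing.Zmodule_isLmodule.Build R[i] histH scaleHA scaleH1 scaleHDr scaleHDl.

Lemma piH_scale c u : piH (c *: u) = c *: piH u.
Proof. exact: piHZ. Qed.

Definition dotH (x y : histH) : R[i] :=
  lim ((dotV (repr x n) (repr y n) : R[i]^o) @[n --> \oo]).

Definition normH (x : histH) : R[i] := sqrtC (dotH x x).

Lemma totV_cvg (u : cauchyV) :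
  exists l : R[i], (totV (u n) : R[i]^o) @[n --> \oo] --> (l : R[i]^o).
Proof.
apply: complex_cauchy_cvg => e e0; case: u => u cu /=.
move/asboolP : (cu) => /(_ e e0)[N hN]; exists N => m n Nm Nn.
by rewrite -totVB -normVE; exact: hN.
Qed.

Definition limH (x : histH) : R[i] :=
  lim ((totV (repr x n) : R[i]^o) @[n --> \oo]).

Lemma limHP (u : cauchyV) :
  (totV (u n) : R[i]^o) @[n --> \oo] --> (limH (piH u) : R[i]^o).
Proof.
have [l ul] := totV_cvg u; have [l' rl] := totV_cvg (repr (piH u)).
rewrite /limH (seq_lim rl).
have /asboolP/normV_cvg0 u0 : u - repr (piH u) \in nullV.
  by rewrite -piH_eq reprH.
have -> : (fun n => totV (u n)) =
    fun n => 1 * totV (repr (piH u) n) + totV ((u - repr (piH u)) n).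
  by apply/funext => n; rewrite mul1r -totVD; congr totV; rewrite /= !fctE addrCA subrr addr0.
have l'E : 1 * l' + 0 = l' by rewrite mul1r addr0.
by have := @seq_cvgZD _ 1 _ _ _ _ rl u0; rewrite l'E.
Qed.

Lemma limH_eq (u : cauchyV) l :
  (totV (u n) : R[i]^o) @[n --> \oo] --> (l : R[i]^o) -> limH (piH u) = l.
Proof. by move=> /seq_lim <-; rewrite (seq_lim (@limHP u)). Qed.

Lemma limH_linear c x y : limH (c *: x + y) = c * limH x + limH y.
Proof.
rewrite -[x]reprH -[y]reprH -piH_scale -piHD; apply: limH_eq.
rewrite (_ : (fun n => _) =
    fun n => c * totV (repr x n) + totV (repr y n)).
  by apply: seq_cvgZD; exact: limHP.
by apply/funext => n; rewrite /= !fctE totV_linear.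
Qed.

Lemma limH_inj x : limH x = 0 -> x = 0.
Proof.
move=> x0; rewrite -[x]reprH; apply/eqP.
have -> : 0 = piH 0 by apply: (addrI (piH 0)); rewrite addr0 -piHD addr0.
rewrite piH_eq subr0; apply/asboolP/normV_cvg0.
by rewrite -x0 -{2}[x]reprH; exact: limHP.
Qed.

Lemma dotHE x y : dotH x y = (limH x)^* * limH y.
Proof.
apply: seq_lim; rewrite (_ : (fun n => _) =
    fun n => (totV (repr x n))^* * totV (repr y n)).
  apply: seq_cvgM; last by rewrite -{2}[y]reprH; exact: limHP.
  have /seq_cvgP := @limHP (repr x); rewrite reprH => h.
  apply/seq_cvgP => e /h[N hN]; exists N => n /hN.
  by rewrite -rmorphB norm_conjC.
by apply/funext => n; rewrite dotVE.
Qed.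

Lemma normHE x : normH x = `|limH x|.
Proof. by rewrite /normH dotHE -normCKC sqrCK. Qed.

Fact normHD x y : normH (x + y) <= normH x + normH y.
Proof. by rewrite !normHE -[x]scale1r limH_linear mul1r scale1r ler_normD. Qed.

Fact normHZ c x : normH (c *: x) = `|c| * normH x.
Proof.
rewrite !normHE -normrM; congr `|_|.
have := limH_linear c x 0; rewrite addr0 => ->.
have := limH_linear 1 0 0; rewrite scale1r mul1r addr0.
by move/esym/eqP; rewrite -[eqbRHS]addr0 (inj_eq (addrI _)) => /eqP ->; rewrite addr0.
Qed.

Fact normH0_eq0 x : normH x = 0 -> x = 0.
Proof. by rewrite normHE => /eqP; rewrite normr_eq0 => /eqP/limH_inj. Qed.

(* The topology of histH is the one given by normH. *)
HB.instance Definition _ :=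
  Lmodule_isNormed.Build R[i] histH normHD normHZ normH0_eq0.

Lemma const_cauchy (u : histV R) : (fun=> u) \in cauchyV_seq.
Proof.
by apply/asboolP => e e0; exists 0 => *; rewrite subrr normVE totV0 normr0.
Qed.

Definition constV (u : histV R) : cauchyV := CauchyV (const_cauchy u).

Definition qvm (a : cyl_algebra) : histH := piH (constV (chi R a)).

Lemma dotH_qvm a b : dotH (qvm a) (qvm b) = decoh a b.
Proof.
have E c : limH (qvm c) = ampl c by rewrite -totV_chi; apply: limH_eq; exact: seq_cvg_cst.
by rewrite dotHE !E.
Qed.

Definition vector_measure (nu : cyl_sigma -> histH) : Prop :=
  forall (F : nat -> cyl_sigma) (E : cyl_sigma),
    trivIset [set: nat] (fun i => val (F i)) ->
    val E = \bigcup_i val (F i) ->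
    \sum_(0 <= i < n) nu (F i) @[n --> \oo] --> nu E.

Definition extends_to_sigma : Prop :=
  exists! nu : cyl_sigma -> histH,
    vector_measure nu /\
    forall (a : cyl_algebra) (E : cyl_sigma), val E = val a -> nu E = qvm a.

End Percolation.

(* Main.v *)
(**
A subset T of an n-element causal set C determines the one-element extension of
C whose new element has the down closure of T as its past; the subsets giving an
extension D are those between the set of links and the past of the new element.
Summing a^|T| b^(n - |T|) over all T yields
  \sum_D (transition amplitude of D) (a + b)^(|past D| - |links D|) = (a + b)^n.
For (a, b) = (p, q) this makes the amplitude additive. For a = |p| and b = |q|,
with a + b >= 1, it bounds \sum_D |transition amplitude of D| below by a + b,
hence the variation of the amplitude over n-element causal sets by
(|p| + |q|)^(n - 1). The real and imaginary parts of a vector measure are finite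
charges, so they have bounded variation; thus an extension forces
|p| + |q| <= 1 = p + q, that is, p in [0, 1].
Conversely, for p in [0, 1] the amplitude is a nonnegative additive set
function, countably additive by compactness of the space of infinite causal sets, and
Caratheodory's theorem extends it; uniqueness is Dynkin's pi-lambda theorem.
*)
From HB Require Import structures.
Require Import Defs.
From mathcomp Require Import all_boot all_order all_algebra.
From mathcomp Require Import finmap complex lra.
From mathcomp Require Import all_classical all_reals all_analysis.
Set Implicit Arguments.
Unset Strict Implicit.
Unset Printing Implicit Defensive.
Import Order.TTheory GRing.Theory Num.Theory.
Import numFieldNormedType.Exports.
Local Open Scope complex_scope.
Local Open Scope ring_scope.

(** * Extensions of a finite causal set by one element *)

Lemma causet_irr n (C : causet n) i : ((i, i) \in prec C) = false.
Proof. by case: C => r /= /and3P[/forallP /(_ i) /negbTE]. Qed.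

Lemma causet_trans n (C : causet n) i j k :
  (i, j) \in prec C -> (j, k) \in prec C -> (i, k) \in prec C.
Proof.
case: C => r /= /and3P[_ /forallP /(_ i) /forallP /(_ j) /forallP /(_ k)].
by move=> /implyP h _ /h /implyP.
Qed.

Lemma causet_lt n (C : causet n) i j : (i, j) \in prec C -> (i < j)%N.
Proof.
by case: C => r /= /and3P[_ _ /forallP /(_ i) /forallP /(_ j) /implyP].
Qed.

Lemma causet_max n (C : causet n.+1) j : ((ord_max, j) \in prec C) = false.
Proof. by apply/negP => /causet_lt /=; rewrite ltnNge -ltnS ltn_ord. Qed.

Lemma lift_max_widen n (i : 'I_n) : lift ord_max i = widen_ord (leqnSn n) i.
Proof. by apply: val_inj; rewrite /= /bump leqNgt ltn_ord. Qed.

Lemma unlift_widen n (i : 'I_n) :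
  unlift ord_max (widen_ord (leqnSn n) i) = Some i.
Proof. by rewrite -lift_max_widen liftK. Qed.

Lemma ord_maxP n (P : 'I_n.+1 -> Prop) :
  (forall i : 'I_n, P (widen_ord (leqnSn n) i)) -> P ord_max -> forall i, P i.
Proof.
by move=> Pw Pm i; case: (unliftP ord_max i) => [j|] ->//;
  rewrite lift_max_widen.
Qed.

Lemma card_ord_widen n (P : pred 'I_n.+1) : ~~ P ord_max ->
  #|P| = #|[set i : 'I_n | P (widen_ord (leqnSn n) i)]|.
Proof.
move=> /negbTE Pm; rewrite -!sum1_card big_mkcond big_ord_recr /=.
rewrite [in X in (_ + X)%N]unfold_in Pm addn0.
by rewrite [RHS]big_mkcond; apply: eq_bigr => i _; rewrite inE.
Qed.

Lemma in_restr n (C : causet n.+1) i j : ((i, j) \in prec (restr C)) =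
  ((widen_ord (leqnSn n) i, widen_ord (leqnSn n) j) \in prec C).
Proof. by rewrite inE. Qed.

Definition past n (C : causet n.+1) : {set 'I_n} :=
  [set i | (widen_ord (leqnSn n) i, ord_max) \in prec C].

Definition links n (C : causet n.+1) : {set 'I_n} :=
  [set i | linked C (widen_ord (leqnSn n) i) ord_max].

Lemma links_sub_past n (C : causet n.+1) : links C \subset past C.
Proof. by apply/fintype.subsetP => i; rewrite !inE => /andP[]. Qed.

Lemma transitionE (R : realType) (a b : R[i]) n (C : causet n.+1) :
  transition a b C = a ^+ #|links C| * b ^+ #|~: past C|.
Proof.
rewrite /transition; congr (_ ^+ _ * _ ^+ _).
  by rewrite card_ord_widen // /linked /= causet_irr.
rewrite card_ord_widen /unrelated /= ?eqxx //.
apply: eq_card => i; rewrite !inE causet_max andbT.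
by rewrite -lift_max_widen eq_sym neq_lift.
Qed.

(** The new element carries the largest label, so nothing lies above it: besides the restriction
    only its past is free. *)
Lemma causet_restr_past_inj n (C D : causet n.+1) :
  restr C = restr D -> past C = past D -> C = D.
Proof.
move=> rCD pCD; apply: val_inj; apply/setP => -[i j] /=.
elim/ord_maxP: i => [i|]; last by rewrite !causet_max.
elim/ord_maxP: j => [j|]; first by rewrite -!in_restr rCD.
by have := congr1 (fun A : {set 'I_n} => i \in A) pCD; rewrite !inE.
Qed.

Definition down n (C : causet n) (T : {set 'I_n}) : {set 'I_n} :=
  [set i | [exists k in T, (i == k) || ((i, k) \in prec C)]].

Lemma downP n (C : causet n) (T : {set 'I_n}) i :
  reflect (exists2 k, k \in T & i = k \/ (i, k) \in prec C) (i \in down C T).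
Proof.
rewrite inE; apply: (iffP exists_inP) => -[k kT h]; exists k => //.
  by case/orP: h => [/eqP|]; [left|right].
by apply/orP; case: h => [->|]; [left|right].
Qed.

(** [unlift ord_max] sends the new element to [None] and an old one to [Some]; the last case makes
    the new element maximal. *)
Definition child_set n (C : causet n) (T : {set 'I_n}) :
    {set 'I_n.+1 * 'I_n.+1} :=
  [set ij | match unlift ord_max ij.1, unlift ord_max ij.2 with
            | Some i, Some j => (i, j) \in prec C
            | Some i, None => i \in down C T
            | None, _ => false
            end].

Lemma child_subproof n (C : causet n) T : is_causet (child_set C T).
Proof.
apply/and3P; split.
- apply/forallP => i; rewrite inE /=.
  by case: (unlift _ _) => // j; rewrite causet_irr.
- apply/forallP => i; apply/forallP => j; apply/forallP => k.
  rewrite !inE /=; case: (unlift _ i) => // i'.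
  case: (unlift _ j) => [j'|]; last by rewrite implybT.
  case: (unlift _ k) => [k'|]; apply/implyP => ij; apply/implyP => jk.
    exact: causet_trans ij jk.
  case/downP: jk => m mT h; apply/downP; exists m => //; right.
  by case: h ij => [->//|jm] ij; exact: causet_trans ij jm.
- apply/forallP => i; apply/forallP => j; rewrite inE /=.
  case: (unliftP _ i) => [i'|] ->//; case: (unliftP _ j) => [j'|] ->.
    by rewrite !lift_max; apply/implyP => /causet_lt.
  by rewrite lift_max ltn_ord implybT.
Qed.

Definition child n (C : causet n) T : causet n.+1 :=
  Causet (child_subproof C T).

Lemma restr_child n (C : causet n) T : restr (child C T) = C.
Proof.
by apply: val_inj; apply/setP => -[i j]; rewrite !inE /= !unlift_widen.
Qed.

Lemma past_child n (C : causet n) T : past (child C T) = down C T.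
Proof. by apply/setP => i; rewrite inE inE /= unlift_widen unlift_none. Qed.

(** Each element of the past equals or lies below a maximal element of the past, and the maximal
    ones are links. *)
Lemma past_sub_down_links n (C : causet n.+1) :
  past C \subset down (restr C) (links C).
Proof.
apply/fintype.subsetP => i ip.
pose P k := (k \in past C) && ((i == k) || ((i, k) \in prec (restr C))).
have Pi : P i by rewrite /P ip eqxx.
(* Labels increase along the order, so a [k] of largest label satisfying [P] is maximal in the
   past. *)
case: (arg_maxnP (fun k : 'I_n => k : nat) Pi) => k /andP[kp ik] kmax.
apply/downP; exists k; last by case/orP: ik => [/eqP|]; [left|right].
move: kp; rewrite !inE /linked => -> /=; apply/existsP => -[m].
elim/ord_maxP: m => [m|]; last by rewrite causet_irr andbF.
rewrite -in_restr => /andP[km mp].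
suff /kmax : P m by apply/negP; rewrite -ltnNge; exact: causet_lt km.
rewrite /P inE mp /=; apply/orP; right.
by case/orP: ik => [/eqP->//|ik]; exact: causet_trans ik km.
Qed.

(** The past of [child C T] is the down closure of [T]. It equals [past D] exactly when [T] lies
    between the maximal elements of that past and the past itself, so the fibres are intervals of
    subsets. *)
Lemma child_eq n (C : causet n) (T : {set 'I_n}) (D : causet n.+1) :
  (child C T == D) =
  [&& C == restr D, links D \subset T & T \subset past D].
Proof.
apply/eqP/and3P => [<-|[/eqP-> lT Tp]]; last first.
  apply: causet_restr_past_inj; rewrite ?restr_child // past_child.
  apply/eqP; rewrite finset.eqEsubset; apply/andP; split.
    apply/fintype.subsetP => i /downP[k /(fintype.subsetP Tp) kp [->//|]].
    by move: kp; rewrite in_restr !inE => kp ik; exact: causet_trans ik kp.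
  apply: (fintype.subset_trans (past_sub_down_links D));
    apply/fintype.subsetP => i /downP[k kl h].
  by apply/downP; exists k => //; exact: (fintype.subsetP lT).
have Td : T \subset past (child C T).
  by rewrite past_child; apply/fintype.subsetP => i iT; apply/downP;
    exists i => //; left.
split => //; first by rewrite restr_child.
apply/fintype.subsetP => i il; have := fintype.subsetP (links_sub_past _) i il.
(* A link strictly below some [k] in [T] would have [k] between itself and the new element. *)
rewrite past_child => /downP[k kT [->//|ik]].
move: il; rewrite inE => /andP[_ /existsP[]]; exists (widen_ord (leqnSn n) k).
rewrite -in_restr restr_child ik /=.
by have := fintype.subsetP Td k kT; rewrite inE.
Qed.

(** * Weighted sums over one-element extensions *)

Lemma prod_indicator (A : comPzRingType) (I : finType) (X : {set I}) (a : A) :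
  \prod_i (if i \in X then a else 1) = a ^+ #|X|.
Proof. by rewrite -big_mkcond prodr_const. Qed.

Lemma sum_weight_interval (A : comPzRingType) n (a b : A) (L P : {set 'I_n}) :
  L \subset P ->
  \sum_(T : {set 'I_n} | (L \subset T) && (T \subset P))
     a ^+ #|T| * b ^+ #|~: T| =
  a ^+ #|L| * b ^+ #|~: P| * (a + b) ^+ #|P :\: L|.
Proof.
move=> LP.
(* Distributing the product of the [f i + g i] gives one term per subset [T]; the zeros kill every
   [T] that leaves [P] or misses a point of [L]. *)
pose f i := if i \in P then a else 0.
pose g i := if i \notin L then b else 0.
transitivity (\prod_(i : 'I_n) (f i + g i)); last first.
  rewrite -!prod_indicator -!big_split; apply: eq_bigr => i _ /=.
  rewrite /f /g !inE; have := fintype.subsetP LP i.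
  by case: (i \in L) => [->//|_]; case: (i \in P) => //=;
    rewrite ?(mul1r, mulr1, addr0, add0r).
rewrite bigA_distr [LHS]big_mkcond; apply: eq_bigr => T _.
case: ifPn => [/andP[/fintype.subsetP LT /fintype.subsetP TP]|].
  rewrite -!prod_indicator -big_split; apply: eq_bigr => i _ /=.
  rewrite /f /g !inE; have := LT i; have := TP i.
  by case: (i \in T) => //= [->//|_]; rewrite ?mulr1 ?mul1r //;
    case: (i \in L) => // /(_ isT).
rewrite negb_and => /orP[] /subsetPn[i ia ib]; rewrite (bigD1 i) //=.
  by rewrite (negbTE ib) /g ia mul0r.
by rewrite ia /f (negbTE ib) mul0r.
Qed.

Lemma sum_weight_child (R : realType) (a b : R[i]) n (D : causet n.+1) :
  \sum_(T | child (restr D) T == D) a ^+ #|T| * b ^+ #|~: T| =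
  transition a b D * (a + b) ^+ #|past D :\: links D|.
Proof.
rewrite transitionE -sum_weight_interval ?links_sub_past //.
by apply: eq_bigl => T; rewrite child_eq eqxx.
Qed.

Lemma sum_transition_weight (R : realType) (a b : R[i]) n (C : causet n) :
  \sum_(D | restr D == C)
    transition a b D * (a + b) ^+ #|past D :\: links D| = (a + b) ^+ n.
Proof.
transitivity (\sum_(T : {set 'I_n}) a ^+ #|T| * b ^+ #|~: T|); last first.
  (* Taken from the empty set to the full set, the interval formula is the binomial theorem. *)
  have := @sum_weight_interval _ n a b finset.set0 [set: 'I_n] (finset.sub0set _).
  rewrite cards0 finset.setCT cards0 finset.setD0 cardsT card_ord !mul1r => <-.
  by apply: eq_bigl => T; rewrite finset.sub0set finset.subsetT.
rewrite (partition_big (child C) (fun D => restr D == C)) => [|T _]; last first.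
  by rewrite restr_child.
by apply: eq_bigr => D /eqP <-; rewrite -sum_weight_child.
Qed.

(** When the weights sum to 1, the correcting powers in [sum_transition_weight] disappear. *)
Lemma sum_transition (R : realType) (p q : R[i]) (hpq : p + q = 1) n
    (C : causet n) : \sum_(D | restr D == C) transition p q D = 1.
Proof.
rewrite -[RHS](expr1n _ n) -hpq -(sum_transition_weight p q C).
by apply: eq_bigr => D _; rewrite hpq expr1n mulr1.
Qed.

Lemma transition_ge0 (R : realType) (a b : R[i]) n (C : causet n.+1) :
  0 <= a -> 0 <= b -> 0 <= transition a b C.
Proof. by move=> a0 b0; rewrite mulr_ge0 ?exprn_ge0. Qed.

Lemma amp_ge0 (R : realType) (a b : R[i]) n (C : causet n) :
  0 <= a -> 0 <= b -> 0 <= amp a b C.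
Proof.
by move=> a0 b0; elim: n C => //= n ih C; rewrite mulr_ge0 ?transition_ge0.
Qed.

Lemma norm_amp (R : realType) (a b : R[i]) n (C : causet n) :
  `|amp a b C| = amp `|a| `|b| C.
Proof.
elim: n C => [|n ih] C /=; first by rewrite normr1.
by rewrite normrM ih /transition normrM !normrX.
Qed.

(* Each exponent of a + b in sum_transition_weight is smaller than the size of C,
   since a nonempty past contains a link. *)
Lemma sum_transition_ge (R : realType) (a b : R[i]) n (C : causet n.+1) :
  0 <= a -> 0 <= b -> 1 <= a + b ->
  a + b <= \sum_(D | restr D == C) transition a b D.
Proof.
move=> a0 b0 s1; have s0 : 0 < a + b by exact: lt_le_trans s1.
rewrite -(ler_pM2r (exprn_gt0 n s0)) -exprS -(sum_transition_weight a b C).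
rewrite mulr_suml; apply: ler_sum => D _.
apply: ler_wpM2l; first exact: transition_ge0.
rewrite ler_weXn2l //; rewrite -ltnS.
(* A link does not belong to the difference, which therefore misses one of the n + 1 points; with no
   link the past itself is empty. *)
have [l0|/card_gt0P[i il]] := posnP #|links D|; last first.
  rewrite ltnS -[X in (_ <= X)%N]/(n.+1.-1) -[X in X.-1]card_ord -cardsT.
  rewrite (cardsD1 i [set: 'I_n.+1]) !inE /= subset_leq_card //.
  by apply/fintype.subsetP => j; rewrite !inE andbT; apply: contraTneq => ->;
    move: il; rewrite !inE => ->.
suff -> : past D = finset.set0 by rewrite finset.set0D cards0.
apply/eqP; rewrite -finset.subset0;
  apply: fintype.subset_trans (past_sub_down_links D) _.
apply/fintype.subsetP => i /downP[k]; move/eqP: l0;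
  rewrite cards_eq0 => /eqP ->.
by rewrite inE.
Qed.

(** Each element after the first contributes at least a factor [a + b]; the first is born with
    amplitude 1, so the exponent is one less than the size. *)
Lemma sum_amp_ge (R : realType) (a b : R[i]) n :
  0 <= a -> 0 <= b -> 1 <= a + b ->
  (a + b) ^+ n <= \sum_(C : causet n.+1) amp a b C.
Proof.
move=> a0 b0 s1; elim: n => [|n ih].
  have C0 : causet 0.
    by exists finset.set0; apply/and3P; split; apply/forallP; case.
  rewrite expr0 (bigD1 (child C0 finset.set0)) //= transitionE.
  have I0 (A : {set 'I_0}) : #|A| = 0.
    by apply/eqP; rewrite -leqn0 -[X in (_ <= X)%N](card_ord 0) max_card.
  rewrite !I0 !mulr1 lerDl.
  by apply: sumr_ge0 => C _; exact: (@amp_ge0 _ a b 1).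
rewrite (partition_big (@restr n.+1) xpredT) //= exprSr.
apply: le_trans (_ : (\sum_(C : causet n.+1) amp a b C) * (a + b) <= _).
  by apply: ler_wpM2r => //; exact: addr_ge0.
rewrite mulr_suml; apply: ler_sum => C _.
apply: le_trans (ler_wpM2l (amp_ge0 C a0 b0) (sum_transition_ge C a0 b0 s1)) _.
by rewrite mulr_sumr; apply: ler_sum => D /eqP <-.
Qed.

(** * Cylinder sets *)

Local Open Scope classical_set_scope.

Lemma res_subproof n (c : inf_causet) :
  is_causet [set ij : 'I_n * 'I_n | iprec c ij.1 ij.2]%SET.
Proof.
apply/and3P; split.
- by apply/forallP => i; rewrite inE /= iprec_irr.
- apply/forallP => i; apply/forallP => j; apply/forallP => k; rewrite !inE /=.
  by apply/implyP => ij; apply/implyP => jk; exact: (iprec_trans ij jk).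
- apply/forallP => i; apply/forallP => j; rewrite inE /=.
  by apply/implyP; exact: iprec_lt.
Qed.

Definition res n (c : inf_causet) : causet n := Causet (res_subproof n c).

Lemma in_res n c i j : ((i, j) \in prec (res n c)) = iprec c i j.
Proof. by rewrite inE. Qed.

Lemma eq_res n c d :
  (forall i j, (i < n)%N -> (j < n)%N -> iprec c i j = iprec d i j) ->
  res n c = res n d.
Proof.
move=> h; apply: val_inj; apply/setP => -[i j].
by rewrite !in_res h.
Qed.

Lemma res_eq n c d i j : res n c = res n d ->
  (i < n)%N -> (j < n)%N -> iprec c i j = iprec d i j.
Proof.
move=> cd i_n j_n.
by rewrite -(in_res c (Ordinal i_n) (Ordinal j_n)) cd in_res.
Qed.

Lemma res_le m n c d : (m <= n)%N -> res n c = res n d -> res m c = res m d.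
Proof.
move=> mn cd; apply: eq_res => i j im jm.
by apply: (res_eq cd); exact: leq_trans mn.
Qed.

Lemma restr_res n c : restr (res n.+1 c) = res n c.
Proof. by apply: val_inj; apply/setP => -[i j]; rewrite in_restr !in_res. Qed.

Lemma cylE n (C : causet n) : cyl C = [set c | res n c = C].
Proof.
apply/seteqP; split => c /= h.
  by apply: val_inj; apply/setP => -[i j]; rewrite in_res h.
by move=> i j; rewrite -h in_res.
Qed.

Lemma res_surj n (C : causet n) : exists c, res n c = C.
Proof.
(* All elements labelled n or more are left unrelated to everything. *)
pose r (i j : nat) := match insub i, insub j with
  | Some i', Some j' => (i', j') \in prec C | _, _ => false end.
have rirr : irreflexive r.
  by move=> i; rewrite /r; case: insubP => // u _ _; rewrite causet_irr.
have rtrans : transitive r.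
  move=> j i k; rewrite /r; case: insubP => // i' _ _;
    case: insubP => // j' _ _.
  by case: insubP => // k' _ _; exact: causet_trans.
have rlt i j : r i j -> (i < j)%N.
  rewrite /r; case: insubP => // i' _ <-; case: insubP => // j' _ <-.
  exact: causet_lt.
exists (InfCauset rirr rtrans rlt).
apply: val_inj; apply/setP => -[i j]; rewrite in_res /= /r.
by rewrite !valK.
Qed.

Lemma causet0_eq (C D : causet 0) : C = D.
Proof. by apply: val_inj; apply/setP => -[[]]. Qed.

(** An invariance form of [has_level], under which complements, unions and passage to a larger level
    are immediate. *)
Definition determined n (E : set inf_causet) :=
  forall c d, res n c = res n d -> E c -> E d.

Lemma determined_le m n E : (m <= n)%N -> determined m E -> determined n E.
Proof. by move=> mn dE c d cd; apply: dE; exact: res_le cd. Qed.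

Lemma determinedC n E : determined n E -> determined n (~` E).
Proof. by move=> dE c d cd nEc Ed; apply: nEc; apply: dE Ed. Qed.

Lemma determinedU n E F :
  determined n E -> determined n F -> determined n (E `|` F).
Proof. by move=> dE dF c d cd [/dE|/dF] h; [left|right]; exact: h. Qed.

Lemma determined_cyl n (C : causet n) : determined n (cyl C).
Proof. by move=> c d; rewrite cylE /= => <-. Qed.

Lemma determined_bigcup n I (P : set I) (F : I -> set inf_causet) :
  (forall i, P i -> determined n (F i)) -> determined n (\bigcup_(i in P) F i).
Proof. by move=> dF c d cd [i Pi Fi]; exists i => //; exact: (dF i Pi c). Qed.

Lemma cyl_subP n E c : determined n E -> cyl (res n c) `<=` E <-> E c.
Proof.
move=> dE; rewrite cylE; split=> [h|Ec d /= dc]; first exact: h.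
by apply: dE Ec.
Qed.

Lemma has_levelP E n : has_level E n <-> determined n E.
Proof.
split=> [->|dE]; first by apply: determined_bigcup => C _;
  exact: determined_cyl.
apply/seteqP; split => [c Ec|c [C /= CE]]; last exact: CE.
by exists (res n c); [apply/cyl_subP|rewrite cylE].
Qed.

(** Finitely many cylinders share the largest of their levels; conversely there are only finitely
    many causal sets of size n. *)
Lemma cyl_algebraP E : cyl_algebra E <-> exists n, determined n E.
Proof.
split=> [[F [/finite_fsetP[s ->] Fc ->]]|[n /[dup] dE /has_levelP En]];
  last first.
  exists (@cyl n @` [set C | cyl C `<=` E]); split.
  - by apply: finite_image; exact: finite_finset.
  - by move=> _ [C _ <-]; exists n, C.
  - by rewrite bigcup_image.
have /choice[l lP] : forall X, exists n, X \in s -> determined n X.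
  move=> X; case: (boolP (X \in s)) => [Xs|_]; last by exists 0.
  by have [n [C ->]] := Fc X Xs; exists n => _; exact: determined_cyl.
exists (\max_(X <- s) l X); apply: determined_bigcup => X /= Xs.
by apply: determined_le (lP X Xs); exact: leq_bigmax_seq.
Qed.

Lemma cyl_algebra0 : cyl_algebra set0.
Proof. by apply/cyl_algebraP; exists 0. Qed.

Lemma cyl_algebraC : setC_closed cyl_algebra.
Proof.
by move=> E /cyl_algebraP[n /determinedC dE]; apply/cyl_algebraP; exists n.
Qed.

Lemma cyl_algebraU : setU_closed cyl_algebra.
Proof.
move=> E F /cyl_algebraP[m dE] /cyl_algebraP[n dF]; apply/cyl_algebraP.
exists (maxn m n); apply: determinedU.
  by apply: determined_le dE; exact: leq_maxl.
by apply: determined_le dF; exact: leq_maxr.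
Qed.

Lemma cyl_algebraI : setI_closed cyl_algebra.
Proof.
move=> E F aE aF; rewrite -[E `&` F]setCK setCI.
by apply: cyl_algebraC; apply: cyl_algebraU; exact: cyl_algebraC.
Qed.

Definition antichain : inf_causet :=
  @InfCauset (fun _ _ => false) (fun=> erefl) (fun _ _ _ _ => id)
    (fun _ _ h => False_ind _ (notF h)).

(* Compactness of the space of infinite causal sets, by Koenig's lemma: [alive
   n c] says that the cylinder of [res n c] meets every [G k]; some one-element
   extension of it is alive again. *)
Lemma cyl_algebra_compact (G : nat -> set inf_causet) :
  (forall k, cyl_algebra (G k)) ->
  (forall k l, (k <= l)%N -> G l `<=` G k) ->
  (forall k, G k !=set0) -> \bigcap_k G k !=set0.
Proof.
move=> aG decG G0.
pose alive n c := forall k, exists2 d, res n d = res n c & G k d.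
have /choice[step stepP] : forall nc : nat * inf_causet, exists d,
    alive nc.1 nc.2 -> res nc.1 d = res nc.1 nc.2 /\ alive nc.1.+1 d.
  move=> [n c] /=.
  have [|nac] := pselect (alive n c); last by exists c.
  move=> ac; apply: contrapT => /forallNP nd.
  have /choice[kf kfP] : forall D : causet n.+1, exists k,
      forall d, res n.+1 d = D -> res n d = res n c -> ~ G k d.
    (* If no [k] excluded [D], a representative of [D] would be an alive extension, against [nd];
       [k = 0] serves to see that [D] restricts to [res n c]. *)
    move=> D; apply: contrapT => /forallNP nk.
    have [d0 d0P] := ac 0.
    have [e eD] := res_surj D; exfalso; apply: (nd e) => _.
    have [d [dD dc _]] : exists d, [/\ res n.+1 d = D, res n d = res n c & G 0 d].
      by have /existsNP[d /not_implyP[h /not_implyP[h' /contrapT h'']]] := nk 0; exists d.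
    split; first by rewrite -dc -(restr_res n d) -(restr_res n e) eD dD.
    move=> k;
      have /existsNP[f /not_implyP[h /not_implyP[h' /contrapT h'']]] := nk k.
    by exists f => //; rewrite h eD.
  (* At the largest of the finitely many bounds every extension is excluded, since [G] decreases,
     yet [res n c] is alive there. *)
  have [d dc GKd] := ac (\max_D kf D).
  apply: (kfP (res n.+1 d) d) => //; apply: decG GKd.
  exact: leq_bigmax.
pose c := fix c n := if n is m.+1 then step (m, c m) else antichain.
have ac n : alive n (c n).
  elim: n => [|n ih]; last exact: (stepP (n, c n) ih).2.
  by move=> k; have [d Gd] := G0 k; exists d => //; exact: causet0_eq.
have cS n : res n (c n.+1) = res n (c n) := (stepP (n, c n) (ac n)).1.
have cle m n : (m <= n)%N -> res m (c n) = res m (c m).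
  elim: n => [|n ih]; first by rewrite leqn0 => /eqP ->.
  rewrite leq_eqVlt ltnS => /predU1P[->//|mn].
  by rewrite -(ih mn); exact: res_le (cS n).
(* The limit order reads [i] and [j] at the first stage containing both; later stages agree by
   [cle]. *)
pose r i j := iprec (c (maxn i j).+1) i j.
have rE n i j : (i < n)%N -> (j < n)%N -> r i j = iprec (c n) i j.
  move=> i_n j_n; apply/esym; apply: (res_eq (n := (maxn i j).+1)).
  - by apply: cle; rewrite gtn_max i_n.
  - by rewrite ltnS leq_maxl.
  - by rewrite ltnS leq_maxr.
have rirr : irreflexive r by move=> i; rewrite /r iprec_irr.
have rtrans : transitive r.
  move=> j i k; pose N := (maxn i (maxn j k)).+1.
  have [iN jN kN] : [/\ (i < N)%N, (j < N)%N & (k < N)%N].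
    by split; rewrite /N ltnS !leq_max leqnn ?orbT.
  by rewrite !(rE N) //; exact: iprec_trans.
have rlt i j : r i j -> (i < j)%N by exact: iprec_lt.
exists (InfCauset rirr rtrans rlt) => k _.
have /cyl_algebraP[n dG] := aG k.
have [d dc Gd] := ac n k.
apply: dG Gd; rewrite dc; apply: eq_res => i j i_n j_n.
by rewrite /= (rE n).
Qed.

(** The remainders after k terms decrease and have empty intersection, so compactness makes one of
    them empty. This turns finite additivity into countable additivity on the algebra. *)
Lemma cyl_algebra_trivIset_finite (F : nat -> set inf_causet) :
  (forall i, cyl_algebra (F i)) -> trivIset setT F ->
  cyl_algebra (\bigcup_i F i) ->
  exists N, forall i, (N <= i)%N -> F i = set0.
Proof.
move=> aF tF aU.
pose G k := \bigcup_i F i `\` \big[setU/set0]_(i < k) F i.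
have aG k : cyl_algebra (G k).
  rewrite /G setDE -[X in X `&` _]setCK -setCU; apply: cyl_algebraC.
  apply: cyl_algebraU; first exact: cyl_algebraC.
  by elim/big_ind: _ => //; [exact: cyl_algebra0|exact: cyl_algebraU].
have decG k l : (k <= l)%N -> G l `<=` G k.
  by move=> kl; apply: setDS; exact: subset_bigsetU.
have [N GN] : exists N, G N = set0.
  apply: contrapT => /forallNP nG.
  have [c Gc] := cyl_algebra_compact aG decG (fun k => (set0P _).1 (introN eqP (nG k))).
  have [[i _ Fic] _] := Gc 0 I.
  have [_] := Gc i.+1 I; apply.
  by rewrite big_ord_recr; right.
exists N => i Ni; apply/seteqP; split => // c Fic.
have : ~ G N c by rewrite GN.
apply; split; first by exists i.
rewrite -bigcup_mkord => -[j /= jN Fjc].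
have ij : i = j by apply: tF => //; exists c.
by move: jN; rewrite -ij ltnNge Ni.
Qed.

(** * The amplitude as a set function *)

(** A cylinder of level n lies inside a level-n set or misses it, so one representative decides. *)
Lemma cyl_subE n (C : causet n) E c :
  determined n E -> res n c = C -> cyl C `<=` E <-> E c.
Proof. by move=> dE <-; exact: cyl_subP. Qed.

Lemma cyl_sub_restr n (C : causet n.+1) E : determined n E ->
  cyl C `<=` E <-> cyl (restr C) `<=` E.
Proof.
have [c cC] := res_surj C; move=> dE; have dE' := determined_le (leqnSn n) dE.
apply: (iff_trans (cyl_subE dE' cC)); apply: iff_sym; apply: (cyl_subE dE).
by rewrite -restr_res cC.
Qed.

Section Amplitude.
Variables (R : realType) (p q : R[i]).
Hypothesis hpq : p + q = 1.

(** [ampl] sums at a level picked by [get]; here the level is an explicit argument. *)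
Definition level_amp n (E : set inf_causet) : R[i] :=
  \sum_(C : causet n | `[< cyl C `<=` E >]) amp p q C.

(** Once the larger causal sets are grouped by restriction, the transition amplitudes in each group
    sum to 1. *)
Lemma level_ampS n E : determined n E -> level_amp n.+1 E = level_amp n E.
Proof.
move=> dE; rewrite /level_amp.
rewrite (partition_big (@restr n) (fun C => `[< cyl C `<=` E >])) /=;
  last first.
  by move=> C /asboolP/(cyl_sub_restr _ dE)/asboolP.
apply: eq_bigr => C /asboolP CE.
rewrite -[RHS]mulr1 -(sum_transition hpq C) mulr_sumr.
apply: eq_big => [D|D /andP[_ /eqP <-]] //.
have [rDC|] := eqVneq (restr D) C; last by rewrite andbF.
by rewrite andbT; apply/asboolP/(cyl_sub_restr _ dE); rewrite rDC.
Qed.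

Lemma level_amp_le m n E : determined m E -> (m <= n)%N ->
  level_amp n E = level_amp m E.
Proof.
move=> dE; elim: n => [|n ih]; first by rewrite leqn0 => /eqP ->.
rewrite leq_eqVlt ltnS => /predU1P[->//|mn].
by rewrite level_ampS ?ih //; exact: determined_le dE.
Qed.

Lemma amplE n (a : cyl_algebra) :
  determined n (val a) -> ampl p q a = level_amp n (val a).
Proof.
move=> dn; rewrite /ampl -/(level_amp _ _).
set m := get _.
have dm : determined m (val a).
  by apply/has_levelP; apply: (@getPex _ [set n | has_level (val a) n]);
    exists n; exact/has_levelP.
(* The picked level and the given one are compared at their maximum. *)
by rewrite -(level_amp_le dm (leq_maxl m n)) (level_amp_le dn (leq_maxr m n)).
Qed.

Lemma level_ampU n E F : determined n E -> determined n F ->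
  E `&` F = set0 -> level_amp n (E `|` F) = level_amp n E + level_amp n F.
Proof.
move=> dE dF EF; rewrite /level_amp (bigID (fun C => `[< cyl C `<=` E >])) /=.
have dEF := determinedU dE dF.
congr (_ + _); apply: eq_bigl => C; have [c cC] := res_surj C;
  rewrite (asbool_equiv_eq (cyl_subE dE cC)) (asbool_equiv_eq (cyl_subE dEF cC));
  rewrite ?(asbool_equiv_eq (cyl_subE dF cC)) asbool_or.
  by case: `[< E c >]; rewrite ?andbF ?orbT.
have : ~~ (`[< E c >] && `[< F c >]).
  by apply/negP => /andP[/asboolP Ec /asboolP Fc]; have : (E `&` F) c by [];
    rewrite EF.
by case: `[< E c >]; case: `[< F c >].
Qed.

Lemma level_amp_set0 n : level_amp n set0 = 0.
Proof.
rewrite /level_amp big_pred0 // => C; apply/asboolP.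
by have [c cC] := res_surj C; move/(cyl_subE (_ : determined n set0) cC); apply.
Qed.

Lemma level_amp_setT n : level_amp n setT = 1.
Proof.
rewrite (@level_amp_le 0) // /level_amp.
rewrite (big_pred1 (res 0 antichain)) // => C.
by rewrite (causet0_eq C (res 0 antichain)) /= eqxx; apply/asboolP.
Qed.

Lemma ampl_set0 (a : cyl_algebra) : val a = set0 -> ampl p q a = 0.
Proof. by move=> a0; rewrite (@amplE 0) a0 // level_amp_set0. Qed.

Lemma ampl_setT (a : cyl_algebra) : val a = setT -> ampl p q a = 1.
Proof. by move=> a0; rewrite (@amplE 0) a0 // level_amp_setT. Qed.

Lemma amplU (a b c : cyl_algebra) : val a `&` val b = set0 ->
  val c = val a `|` val b -> ampl p q c = ampl p q a + ampl p q b.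
Proof.
move=> ab0 cab.
have /cyl_algebraP[m da] := set_valP a; have /cyl_algebraP[n db] := set_valP b.
have {}da := determined_le (leq_maxl m n) da.
have {}db := determined_le (leq_maxr m n) db.
rewrite (amplE da) (amplE db) -level_ampU // -cab; apply: amplE.
by rewrite cab; exact: determinedU.
Qed.

(** * The histories Hilbert space as the complex line *)

Lemma limH_qvm a : limH (qvm p q a) = ampl p q a.
Proof. by rewrite -totV_chi; apply: limH_eq; exact: seq_cvg_cst. Qed.

Lemma limH0 : limH (0 : histH p q) = 0.
Proof.
have := limH_linear 1 (0 : histH p q) 0; rewrite scale1r mul1r addr0.
by move/esym/eqP; rewrite -[eqbRHS]addr0 (inj_eq (addrI _)) => /eqP.
Qed.

Lemma limHB (x y : histH p q) : limH (x - y) = limH x - limH y.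
Proof. by rewrite -scaleN1r addrC limH_linear mulN1r addrC. Qed.

Lemma limH_sum I (r : seq I) P (F : I -> histH p q) :
  limH (\sum_(i <- r | P i) F i) = \sum_(i <- r | P i) limH (F i).
Proof.
apply: (big_morph (@limH R p q)) => [x y|]; last exact: limH0.
by rewrite -[x]scale1r limH_linear mul1r scale1r.
Qed.

(** With [limH_surj], [limH_linear] and [normHE], this identifies the histories Hilbert space
    isometrically with the complex numbers. *)
Lemma limH_injective : injective (@limH R p q).
Proof.
by move=> x y xy; apply/eqP; rewrite -subr_eq0; apply/eqP/limH_inj;
  rewrite limHB xy subrr.
Qed.

Lemma limH_surj z : exists x : histH p q, limH x = z.
Proof.
have T : cyl_algebra setT by apply/cyl_algebraP; exists 0.
(* The vector of the whole space has amplitude 1, so it spans. *)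
exists (z *: qvm p q (SigSub (mem_set T))).
rewrite -[X in limH X]addr0 limH_linear limH0 addr0 limH_qvm ampl_setT //.
by rewrite mulr1.
Qed.

Lemma cvg_limH (x : nat -> histH p q) (y : histH p q) :
  x n @[n --> \oo] --> y <-> forall e : R[i], 0 < e ->
     exists N, forall n, (N <= n)%N -> `|limH (x n) - limH y| < e.
Proof.
have E (a b : histH p q) : `|a - b| = `|limH a - limH b| :> R[i].
  by rewrite -(limHB a b) -normHE.
split=> [/cvgrPdist_lt h e e0|h].
  by have [N _ hN] := h e e0; exists N => n /hN; rewrite distrC E.
apply/cvgrPdist_lt => e e0; have [N hN] := h e e0.
by exists N => // n /hN; rewrite -E distrC.
Qed.

End Amplitude.

(** * Extensions to the sigma-algebra have bounded variation *)

HB.instance Definition _ := gen_eqMixin inf_causet.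
HB.instance Definition _ := gen_choiceMixin inf_causet.
HB.instance Definition _ := isPointed.Build inf_causet antichain.

Lemma cyl_sigma_algebra : sigma_algebra setT cyl_sigma.
Proof. exact: smallest_sigma_algebra. Qed.

Lemma cyl_algebra_sigma : cyl_algebra `<=` cyl_sigma.
Proof. exact: sub_sigma_algebra. Qed.

Section Necessity.
Variables (R : realType) (p q : R[i]).
Hypothesis hpq : p + q = 1.
Variable nu : cyl_sigma -> histH p q.
Hypothesis nuV : vector_measure nu.
Hypothesis nuE : forall (a : cyl_algebra) (E : cyl_sigma),
  val E = val a -> nu E = qvm p q a.

(** The complex measure behind [nu], made total with value 0 off [cyl_sigma] because a charge is a
    function on all sets. *)
Definition nu_ampl (E : set inf_causet) : R[i] :=
  if insub E is Some e then limH (nu e) else 0.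

Lemma nu_amplE (e : cyl_sigma) : nu_ampl (val e) = limH (nu e).
Proof. by rewrite /nu_ampl valK. Qed.

Lemma nu_ampl_level n E : determined n E -> nu_ampl E = level_amp p q n E.
Proof.
move=> dE.
have aE : cyl_algebra E by apply/cyl_algebraP; exists n.
rewrite (nu_amplE (SigSub (mem_set (cyl_algebra_sigma aE)))).
rewrite (nuE (a := SigSub (mem_set aE))) // limH_qvm.
exact: (amplE hpq (a := SigSub (mem_set aE))).
Qed.

Lemma nu_ampl_sigma_additive (F : nat -> set inf_causet) :
  (forall i, cyl_sigma (F i)) -> trivIset setT F ->
  forall e : R[i], 0 < e -> exists N, forall n, (N <= n)%N ->
    `|\sum_(0 <= i < n) nu_ampl (F i) - nu_ampl (\bigcup_i F i)| < e.
Proof.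
move=> mF tF e e0.
have mU : cyl_sigma (\bigcup_i F i).
  by have [_ _] := cyl_sigma_algebra; apply.
pose G i : cyl_sigma := SigSub (mem_set (mF i)).
pose U : cyl_sigma := SigSub (mem_set mU).
have [|N hN] := (cvg_limH (fun n => \sum_(0 <= i < n) nu (G i)) (nu U)).1 _ e e0.
  exact: nuV.
exists N => n /hN; rewrite limH_sum -(nu_amplE U).
by under eq_bigr do rewrite -nu_amplE.
Qed.

Lemma nu_ampl_cvg (F : nat -> set inf_causet) :
  (forall i, cyl_sigma (F i)) -> trivIset setT F ->
  ((\sum_(0 <= i < n) nu_ampl (F i)) : R[i]^o) @[n --> \oo] -->
    (nu_ampl (\bigcup_i F i) : R[i]^o).
Proof. by move=> mF tF; apply/seq_cvgP; exact: nu_ampl_sigma_additive. Qed.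

Lemma nu_amplC E : cyl_sigma E -> nu_ampl (~` E) = 1 - nu_ampl E.
Proof.
move=> mE; have [m0 mC _] := cyl_sigma_algebra.
have mCE : cyl_sigma (~` E) by rewrite -setTD; exact: mC.
(* Countable additivity yields the finite case by padding with empty sets from index 2 on. *)
have mF i : cyl_sigma (bigcup2 E (~` E) i) by case: i => [|[|]].
have tF : trivIset setT (bigcup2 E (~` E)).
  by rewrite -trivIset_bigcup2 setICr.
have /seq_lim := nu_ampl_cvg mF tF; rewrite bigcup2E setUCr.
rewrite (@nu_ampl_level 0) // level_amp_setT // => <-.
apply/eqP; rewrite eq_sym subr_eq addrC; apply/eqP/seq_lim.
apply: cvg_near_cst; exists 2 => // n /= n2.
rewrite (big_cat_nat (n := 2)) //= big_nat_recr //= big_nat1 /=.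
rewrite big_nat_cond big1 ?addr0 // => -[|[|i]] //= _.
by rewrite (@nu_ampl_level 0) // level_amp_set0.
Qed.

(** Meant for the real and imaginary parts: composed with [g], the extension is a finite signed
    measure, and the total mass of its Hahn variation bounds all its values. *)
Lemma nu_ampl_part_bounded (g : {additive R[i] -> R})
    (g_le : forall z, `|g z|%:C <= `|z|) :
  exists K : R, forall E, cyl_sigma E -> `|g (nu_ampl E)| <= K.
Proof.
pose T := g_sigma_algebraType cyl_algebra.
pose mu (E : set T) : \bar R := (g (nu_ampl E))%:E.
have mu0 : mu set0 = 0%E.
  by rewrite /mu (@nu_ampl_level 0) // level_amp_set0 raddf0.
have mufin E : measurable E -> mu E \is a fin_num by [].
have musig : semi_sigma_additive mu.
  move=> F mF tF mUF; rewrite /mu.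
  under eq_fun do rewrite sumEFin.
  apply: cvg_EFin; first by near=> n.
  apply/cvgrPdist_lt => e e0.
  have [|N hN] := nu_ampl_sigma_additive mF tF (e := e%:C);
    first by rewrite ltcR.
  exists N => // n /hN h; rewrite distrC /= -raddf_sum -raddfB -ltcR.
  exact: le_lt_trans (g_le _) h.
pose nuc : charge T R := HB.pack mu (isCharge.Build _ T R mu mu0 mufin musig).
have [P [N PN]] := Hahn_decomposition nuc.
pose V := charge_variation PN.
exists (fine (V setT)) => E mE.
rewrite -lee_fin fineK; last exact: fin_num_measure.
apply: le_trans (le_measure V _ _ (@subsetT _ E)); rewrite ?inE //.
exact: (abse_charge_variation PN mE).
Unshelve. all: by end_near. Qed.

(** The cylinders of any family of causal sets of size n are disjoint, so the family's sum is one
    value of the charge; splitting by sign gives twice the bound on such values. *)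
Lemma sum_part_bounded (g : {additive R[i] -> R})
    (g_le : forall z, `|g z|%:C <= `|z|) :
  exists K : R, forall n, \sum_(C : causet n) `|g (amp p q C)| <= K.
Proof.
have [K hK] := nu_ampl_part_bounded g_le; exists (K + K) => n.
have key (P : pred (causet n)) : `|\sum_(C | P C) g (amp p q C)| <= K.
  pose E := \bigcup_(C in [set C | P C]) cyl C.
  have dE : determined n E by apply: determined_bigcup => C _;
    exact: determined_cyl.
  have -> : \sum_(C | P C) g (amp p q C) = g (nu_ampl E).
    rewrite (nu_ampl_level dE) raddf_sum; apply: eq_bigl => C.
    have [c cC] := res_surj C.
    apply/idP/asboolP => [PC|/(cyl_subE dE cC)]; first by move=> d Cd; exists C.
    by move=> [D /= PD]; rewrite cylE /= cC => ->.
  by apply: hK; apply: cyl_algebra_sigma; apply/cyl_algebraP; exists n.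
rewrite (bigID (fun C => 0 <= g (amp p q C))) /=; apply: lerD.
  apply: le_trans (key (fun C => 0 <= g (amp p q C)));
    rewrite ger0_norm ?sumr_ge0 //.
  by apply: ler_sum => C h; rewrite ger0_norm.
apply: le_trans (key (fun C => ~~ (0 <= g (amp p q C)))).
rewrite -normrN -sumrN ger0_norm; last first.
  by apply: sumr_ge0 => C; rewrite -ltNge oppr_ge0 => /ltW.
by apply: ler_sum => C; rewrite -ltNge => h; rewrite ltr0_norm.
Qed.

Lemma sum_norm_amp_bounded :
  exists K : R, forall n, \sum_(C : causet n) `|amp p q C| <= K%:C.
Proof.
have [|K hK] := @sum_part_bounded (@complex.Re R); first exact: normc_ge_Re.
have [|L hL] := @sum_part_bounded (@complex.Im R); first exact: normc_ge_Im.
exists (K + L) => n; apply: (@le_trans _ _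
  (\sum_(C : causet n) (`|complex.Re (amp p q C)| + `|complex.Im (amp p q C)|)%:C)).
  apply: ler_sum => C _; case: (amp p q C) => x y.
  have -> : x +i* y = x%:C + (0 +i* y) by simpc.
  apply: le_trans (ler_normD _ _) _; rewrite rmorphD /= addr0 add0r.
  by apply: lerD; rewrite normc_def /= expr0n /= ?addr0 ?add0r sqrtr_sqr.
by rewrite -rmorph_sum lecR big_split lerD.
Qed.

Lemma norm_ampl_le1 : `|p| + `|q| <= 1.
Proof.
have [K hK] := sum_norm_amp_bounded.
have Creal (z : R[i]) : `|z| = (complex.Re `|z|)%:C :> R[i] by rewrite normc_def.
have s1 : 1 <= `|p| + `|q| by rewrite -(normr1 R[i]) -hpq ler_normD.
pose s := complex.Re `|p| + complex.Re `|q|.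
have sE : `|p| + `|q| = s%:C by rewrite Creal [X in _ + X]Creal -rmorphD.
have sK n : s ^+ n <= K.
  rewrite -lecR rmorphXn /= -sE; apply: le_trans (hK n.+1).
  under eq_bigr do rewrite norm_amp.
  exact: sum_amp_ge.
rewrite sE lecR leNgt; apply/negP => s_gt1.
(* Bernoulli's inequality makes the powers unbounded for [s > 1], against [sK]. *)
have bern n : n%:R * (s - 1) <= s ^+ n.
  elim: n => [|n ih]; first by rewrite mul0r expr0.
  have : 1 <= s ^+ n by rewrite exprn_ege1 // ltW.
  by rewrite exprS -natr1; nra.
have K0 : 0 <= K by apply: le_trans (sK 0); rewrite expr0.
have s_ge1 : 0 <= s - 1 by rewrite subr_ge0 ltW.
have := archi_boundP (divr_ge0 K0 s_ge1).
by rewrite ltr_pdivrMr ?subr_gt0 // ltNge (le_trans (bern _)).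
Qed.

End Necessity.

(** Equality case of the triangle inequality: the two norms dominate the real parts of [p] and
    [1 - p], which already sum to 1. *)
Lemma unit_interval_of_norm (R : realType) (p q : R[i]) : p + q = 1 ->
  `|p| + `|q| <= 1 -> complex.Im p = 0 /\ 0 <= complex.Re p <= 1.
Proof.
move=> pq; have -> : q = 1 - p by rewrite -pq addrAC subrr add0r.
rewrite {pq}.
case: p => x y; rewrite !normc_def -rmorphD lecR /= => h.
have [x1 x2] : x <= Num.sqrt (x ^+ 2 + y ^+ 2) /\
    1 - x <= Num.sqrt ((1 - x) ^+ 2 + (0 - y) ^+ 2).
  split; apply: le_trans (ler_norm _) _; rewrite -sqrtr_sqr ler_wsqrtr //;
    by rewrite lerDl sqr_ge0.
have E1 : Num.sqrt (x ^+ 2 + y ^+ 2) = x by lra.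
have E2 : Num.sqrt ((1 - x) ^+ 2 + (0 - y) ^+ 2) = 1 - x by lra.
have x_ge0 : 0 <= x by rewrite -E1 sqrtr_ge0.
have x_le1 : 0 <= 1 - x by rewrite -E2 sqrtr_ge0.
split; last by rewrite x_ge0 -subr_ge0.
apply/eqP; rewrite -sqrf_eq0 -(inj_eq (addrI (x ^+ 2))) addr0.
by rewrite -[X in _ == X ^+ 2]E1 sqr_sqrtr // addr_ge0 ?sqr_ge0.
Qed.

(** * Existence and uniqueness for p in [0, 1] *)

(** The sets on which the two amplitudes agree form a Dynkin system containing the
    intersection-stable algebra; injectivity of [limH] lifts agreement to vectors. *)
Lemma vector_measure_extension_unique (R : realType) (p q : R[i])
    (nu nu' : cyl_sigma -> histH p q) : p + q = 1 ->
  vector_measure nu -> vector_measure nu' ->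
  (forall (a : cyl_algebra) (E : cyl_sigma), val E = val a -> nu E = qvm p q a) ->
  (forall (a : cyl_algebra) (E : cyl_sigma), val E = val a -> nu' E = qvm p q a) ->
  nu = nu'.
Proof.
move=> hpq nuV nuV' nuE nuE'.
pose agree : set (set inf_causet) :=
  [set E | cyl_sigma E /\ nu_ampl nu E = nu_ampl nu' E].
have agree_alg n E : determined n E -> agree E.
  move=> dE; split; first by apply: cyl_algebra_sigma; apply/cyl_algebraP;
    exists n.
  by rewrite (nu_ampl_level hpq nuE dE) (nu_ampl_level hpq nuE' dE).
have dynkin_agree : dynkin agree.
  split.
  - exact: (@agree_alg 0).
  - move=> E [mE EE]; have [_ mC _] := cyl_sigma_algebra.
    have mCE : cyl_sigma (~` E) by rewrite -setTD; exact: mC.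
    split => //.
    by rewrite (nu_amplC hpq nuV nuE) // (nu_amplC hpq nuV' nuE') // EE.
  - move=> F tF /all_and2[mF FE]; have [_ _ mU] := cyl_sigma_algebra.
    split; first exact: mU.
    rewrite -(seq_lim (nu_ampl_cvg nuV mF tF)) -(seq_lim (nu_ampl_cvg nuV' mF tF)).
    by under eq_fun do under eq_bigr do rewrite FE.
apply/funext => E; apply: limH_injective; rewrite -!nu_amplE.
suff : cyl_sigma `<=` agree by move=> /(_ _ (set_valP E))[].
rewrite /cyl_sigma -setI_closed_g_dynkin_g_sigma_algebra;
  last exact: cyl_algebraI.
by apply: smallest_sub => // F /cyl_algebraP[n]; exact: agree_alg.
Qed.

(** * The Caratheodory extension of the amplitude *)

Fact cyl_display : measure_display. Proof. by []. Qed.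

(** On [inf_causet] itself the measurable sets are those of [cyl_algebra]; the sigma algebra lives
    on [g_sigma_algebraType cyl_algebra]. *)
HB.instance Definition _ := isAlgebraOfSets.Build cyl_display inf_causet
  cyl_algebra0 cyl_algebraU cyl_algebraC.

Section Sufficiency.
Variables (R : realType) (p q : R[i]).
Hypotheses (hpq : p + q = 1) (p_ge0 : 0 <= p) (q_ge0 : 0 <= q).

Lemma ampl_ge0 a : 0 <= ampl p q a.
Proof. by apply: sumr_ge0 => C _; exact: amp_ge0. Qed.

Lemma amplRe a : (complex.Re (ampl p q a))%:C = ampl p q a.
Proof. by rewrite RRe_real // ger0_real // ampl_ge0. Qed.

(** Amplitudes are nonnegative here, so the real part loses nothing ([amplRe]); the 0 off the
    algebra is a default value. *)
Definition premeasure (E : set inf_causet) : \bar R :=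
  (if insub E is Some a then complex.Re (ampl p q a) else 0)%:E.

Lemma premeasureE (a : cyl_algebra) :
  premeasure (val a) = (complex.Re (ampl p q a))%:E.
Proof. by rewrite /premeasure valK. Qed.

Lemma premeasure0 : premeasure set0 = 0%E.
Proof.
by rewrite (premeasureE (SigSub (mem_set cyl_algebra0))) ampl_set0.
Qed.

Lemma premeasure_ge0 E : (0 <= premeasure E)%E.
Proof.
rewrite /premeasure lee_fin; case: insub => // a.
by rewrite -lecR amplRe ampl_ge0.
Qed.

Lemma premeasureU E F : cyl_algebra E -> cyl_algebra F -> E `&` F = set0 ->
  premeasure (E `|` F) = (premeasure E + premeasure F)%E.
Proof.
move=> aE aF EF; have aEF := cyl_algebraU aE aF.
rewrite (premeasureE (SigSub (mem_set aE))) (premeasureE (SigSub (mem_set aF))).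
rewrite (premeasureE (SigSub (mem_set aEF))) -EFinD -raddfD;
  congr (complex.Re _)%:E.
exact: amplU.
Qed.

Lemma cyl_algebra_bigsetU (F : nat -> set inf_causet) n :
  (forall i, cyl_algebra (F i)) -> cyl_algebra (\big[setU/set0]_(i < n) F i).
Proof.
by move=> aF; elim/big_ind: _ => //; [exact: cyl_algebra0|exact: cyl_algebraU].
Qed.

Lemma premeasure_bigsetU (F : nat -> set inf_causet) n :
  (forall i, cyl_algebra (F i)) -> trivIset setT F ->
  premeasure (\big[setU/set0]_(i < n) F i) = (\sum_(0 <= i < n) premeasure (F i))%E.
Proof.
move=> aF tF; elim: n => [|n ih].
  by rewrite big_ord0 big_geq // premeasure0.
rewrite big_ord_recr big_nat_recr //= -ih; apply: premeasureU => //.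
  exact: cyl_algebra_bigsetU.
by apply: (@trivIset_bigsetUI _ predT) => //; rewrite /predT /= trueE.
Qed.

(** Compactness leaves only finitely many nonempty pieces, so the partial sums are eventually
    constant. *)
Lemma premeasure_sigma_additive : semi_sigma_additive premeasure.
Proof.
move=> F mF tF mU; have [N FN] := cyl_algebra_trivIset_finite mF tF mU.
apply: cvg_near_cst; exists N => // n /= Nn.
rewrite -premeasure_bigsetU //; congr premeasure.
rewrite -bigcup_mkord; apply/seteqP; split => [c [i _ Fi]|c [i _ Fi]];
  exists i => //=.
by rewrite ltnNge; apply/negP => ni; move: Fi; rewrite FN //;
  exact: leq_trans ni.
Qed.

HB.instance Definition _ := isMeasure.Build _ _ R premeasure
  premeasure0 premeasure_ge0 premeasure_sigma_additive.

Let M : {measure set (g_sigma_algebraType cyl_algebra) -> \bar R} :=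
  measure_extension premeasure.

Lemma extensionE E : cyl_algebra E -> M E = premeasure E.
Proof. by move=> aE; rewrite /M /= /measure_extension measurable_mu_extE. Qed.

Lemma extension_fin E : cyl_sigma E -> M E \is a fin_num.
Proof.
move=> mE; have aT : cyl_algebra setT by apply/cyl_algebraP; exists 0.
have MT : (M setT < +oo)%E by rewrite extensionE // ltry.
by rewrite ge0_fin_numE // (le_lt_trans _ MT) // le_measure ?inE.
Qed.

Lemma vector_measure_extension_exists : exists nu : cyl_sigma -> histH p q,
  vector_measure nu /\
  forall (a : cyl_algebra) (E : cyl_sigma), val E = val a -> nu E = qvm p q a.
Proof.
(* [f] is a right inverse of [limH]; it turns the Caratheodory mass of a set into a vector. *)
have /choice[f fE] := limH_surj hpq.
exists (fun E => f (fine (M (val E)))%:C); split=> [F E tF EF|a E Ea];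
  last first.
  apply: limH_injective; rewrite fE limH_qvm Ea extensionE;
    last exact: set_valP.
  by rewrite premeasureE /= amplRe.
have mF i : cyl_sigma (val (F i)) by exact: set_valP.
have mE : cyl_sigma (val E) by exact: set_valP.
apply/cvg_limH => e e0.
have eE : e = (complex.Re e)%:C by rewrite RRe_real // gtr0_real.
have h : (\sum_(0 <= i < n) M (val (F i)))%E @[n --> \oo] -->
    (fine (M (val E)))%:E.
  rewrite fineK; last exact: extension_fin.
  by rewrite EF; apply: measure_semi_sigma_additive; rewrite -?EF.
have /fine_cvgP[_ /cvgrPdist_lt /(_ (complex.Re e))] := h.
case; first by rewrite -ltcR -eE.
move=> N _ hN; exists N => n /hN /=.
rewrite distrC -sum_fine => [hn|i _]; last exact: extension_fin (mF i).
rewrite limH_sum fE; under eq_bigr do rewrite fE.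
by rewrite -rmorph_sum -rmorphB /= normc_def /= expr0n addr0 sqrtr_sqr eE ltcR.
Qed.

End Sufficiency.

Lemma unit_interval_ge0 (R : realType) (p q : R[i]) : p + q = 1 ->
  complex.Im p = 0 /\ 0 <= complex.Re p <= 1 -> 0 <= p /\ 0 <= q.
Proof.
move=> pq; have -> : q = 1 - p by rewrite -pq addrAC subrr add0r.
case: p {pq} => x y /= [-> /andP[x0 x1]].
by rewrite !lecE /= subrr eqxx subr_ge0.
Qed.

(** On two-element causal sets nonnegative amplitudes equal their norms and sum to 1, while
    [sum_amp_ge] bounds the sum of the norms below by the norm of [p] plus that of [q]. *)
Lemma unit_interval_of_amp_ge0 (R : realType) (p q : R[i]) : p + q = 1 ->
  (forall n (C : causet n), 0 <= amp p q C) ->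
  complex.Im p = 0 /\ 0 <= complex.Re p <= 1.
Proof.
move=> hpq amp0; apply: (unit_interval_of_norm hpq).
have s1 : 1 <= `|p| + `|q| by rewrite -(normr1 R[i]) -hpq ler_normD.
rewrite -[leLHS]expr1; apply: le_trans (sum_amp_ge 1 _ _ s1) _ => //.
rewrite -(level_amp_setT hpq 2) le_eqVlt; apply/orP; left; apply/eqP.
apply: eq_big => [C|C _]; first by apply/esym/asboolP.
by rewrite -norm_amp ger0_norm.
Qed.

Theorem mainTheorem7 (R : realType) (p q : R[i]) (hpq : p + q = 1) :
  (extends_to_sigma p q <->
     (complex.Im p = 0 /\ 0 <= complex.Re p <= 1)) /\
  ((complex.Im p = 0 /\ 0 <= complex.Re p <= 1) <->
     forall (n : nat) (C : causet n), 0 <= amp p q C).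
Proof.
split; split.
- case=> nu [[nuV nuE] _]; apply: (unit_interval_of_norm hpq).
  exact (norm_ampl_le1 hpq nuV nuE).
- move=> /(unit_interval_ge0 hpq)[p0 q0].
  have [nu [nuV nuE]] := vector_measure_extension_exists hpq p0 q0.
  exists nu; split => // nu' [nuV' nuE'].
  exact: vector_measure_extension_unique hpq nuV nuV' nuE nuE'.
- by move=> /(unit_interval_ge0 hpq)[p0 q0] n C; exact: amp_ge0.
- exact: unit_interval_of_amp_ge0.
Qed.
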